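(* For every $n\ge1$, the number of loopless and coloopless Schubert matroids on $[n]$ is equal to the number of derangements of $[n]$ (permutations of $[n]$ without fixed points).
   Context: $[n]=\{1,\dots,n\}$. For $w\in S_n$ let $\le_w$ be the induced linear order on $[n]$ and also the Gale order on $k$-element subsets of $[n]$: $\{i_1<_w\dots<_wi_k\}\le_w\{j_1<_w\dots<_wj_k\}$ iff $i_a\le_wj_a$ for all $1\le a\le k$. For $S\subseteq[n]$ with $|S|=k$ ($0\le k\le n$), the Schubert matroid $\Omega_S^w$ is the matroid on $[n]$ with set of bases $\{T\in\binom{[n]}k:S\le_wT\}$. Schubert matroids on $[n]$ are all matroids of the form $\Omega_S^w$, counted as matroids (i.e. as distinct sets of bases; different pairs $(w,S)$ may give the same matroid). A matroid is loopless if every element lies in some basis, and coloopless if no element lies in every basis. *)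

(* Defs.v *)
From HB Require Import structures.
From mathcomp Require Import all_boot all_order all_fingroup.

Set Implicit Arguments.
Unset Strict Implicit.
Unset Printing Implicit Defensive.

(* The ground set [n] = {1, ..., n} is rendered as 'I_n = {0, ..., n - 1}. *)

(** ** Matroids on a finite ground set, given by their bases *)

Definition basis_exchange (T : finType) (B : {set {set T}}) : bool :=
  [forall A1 in B, forall A2 in B, forall x in A1 :\: A2,
     exists y in A2 :\: A1, y |: (A1 :\ x) \in B].

(* The axioms are boolean, hence proof-irrelevant: two matroids are equal      *)
(* exactly when their sets of bases are.                                       *)
Record matroid (T : finType) := Matroid {
  bases :> {set {set T}};
  matroid_axiom : (bases != set0) && basis_exchange bases }.

HB.instance Definition _ (T : finType) := [isSub for @bases T].
HB.instance Definition _ (T : finType) := [Finite of matroid T by <:].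

Definition loopless (T : finType) (M : matroid T) : bool :=
  [forall x, exists B in bases M, x \in B].

Definition coloopless (T : finType) (M : matroid T) : bool :=
  [forall x, ~~ [forall B in bases M, x \in B]].

(** ** Gale order and Schubert matroids *)

(* w(1) <_w w(2) <_w ... <_w w(n) *)
Definition le_perm (n : nat) (w : 'S_n) : rel 'I_n :=
  fun i j => ((w^-1)%g i <= (w^-1)%g j)%N.

(* [all2] also requires the two lists to have the same length. *)
Definition gale_le (n : nat) (w : 'S_n) (S T : {set 'I_n}) : bool :=
  all2 (le_perm w) (sort (le_perm w) (enum S)) (sort (le_perm w) (enum T)).

Definition schubert_bases (n : nat) (w : 'S_n) (S : {set 'I_n}) :
    {set {set 'I_n}} :=
  [set T : {set 'I_n} | (#|T| == #|S|) && gale_le w S T].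

Section SchubertExchange.
Variables (n : nat) (w : 'S_n).
Local Notation le := (le_perm w).

Lemma le_perm_refl : reflexive le.
Proof. by move=> x; apply: leqnn. Qed.

Lemma le_perm_trans : transitive le.
Proof. by move=> y x z; apply: leq_trans. Qed.

Lemma le_perm_total : total le.
Proof. by move=> x y; apply: leq_total. Qed.

Lemma le_perm_anti : antisymmetric le.
Proof. by move=> x y /anti_leq /val_inj /perm_inj. Qed.

Lemma all2_countP (s t : seq 'I_n) :
  sorted le s -> sorted le t -> size s = size t ->
  reflect (forall c, count (le^~ c) t <= count (le^~ c) s) (all2 le s t).
Proof.
move=> ss st sz; apply: (iffP idP).
  elim: s t sz {ss st} => [|x s IH] [|y t] //= [sz] /andP[xy st] c.
  apply: leq_add; last exact: IH.
  by case yc: (le y c) => //; rewrite (le_perm_trans xy yc).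
elim: s t ss st sz => [|x s IH] [|y t] //= ss st [sz] H.
have xy : le x y.
  have := H y; rewrite le_perm_refl /=; case xy: (le x y) => //=.
  rewrite add0n => /(leq_trans (ltn0Sn _)); rewrite -has_count.
  case/hasP => z zs zy.
  have /allP/(_ z zs) xz := order_path_min le_perm_trans ss.
  by rewrite (le_perm_trans xz zy) in xy.
rewrite xy /=; apply: IH; [exact: path_sorted ss | exact: path_sorted st | by [] |].
move=> c; case yc: (le y c).
  by have := H c; rewrite yc (le_perm_trans xy yc) leq_add2l.
suff -> : count (le^~ c) t = 0 by [].
apply/eqP; rewrite -leqn0 leqNgt -has_count; apply/hasPn => z zt.
have /allP/(_ z zt) yz := order_path_min le_perm_trans st.
by apply/negP => zc; rewrite (le_perm_trans yz zc) in yc.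
Qed.

Lemma gale_leP (S T : {set 'I_n}) : #|T| = #|S| ->
  reflect (forall c, #|[set z in T | le z c]| <= #|[set z in S | le z c]|)
          (gale_le w S T).
Proof.
move=> cTS.
have cnt (A : {set 'I_n}) c :
    count (le^~ c) (sort le (enum A)) = #|[set z in A | le z c]|.
  rewrite (seq.permP (permEl (perm_sort le (enum A)))) -size_filter.
  rewrite [RHS]cardE; apply/perm_size/uniq_perm.
  - by rewrite filter_uniq ?enum_uniq.
  - exact: enum_uniq.
  by move=> z; rewrite mem_filter !mem_enum !inE andbC.
apply: (iffP (all2_countP _ _ _)).
- exact: sort_sorted le_perm_total _.
- exact: sort_sorted le_perm_total _.
- by rewrite !size_sort -!cardE cTS.
- by move=> H c; rewrite -!cnt.
- by move=> H c; rewrite !cnt.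
Qed.

Lemma schubert_bases_matroid (S : {set 'I_n}) :
  (schubert_bases w S != set0) && basis_exchange (schubert_bases w S).
Proof.
apply/andP; split.
  apply/set0Pn; exists S; rewrite inE eqxx /=.
  by apply/gale_leP.
apply/forall_inP => A1; rewrite inE => /andP[/eqP c1 /(gale_leP c1) g1].
apply/forall_inP => A2; rewrite inE => /andP[/eqP c2 /(gale_leP c2) g2].
apply/forall_inP => x; rewrite inE => /andP[xA2 xA1].
have cD : #|A2 :\: A1| = #|A1 :\: A2|.
  by rewrite !cardsD setIC c1 c2.
have [y yA] : exists y, y \in A2 :\: A1.
  apply/set0Pn; rewrite -card_gt0 cD card_gt0; apply/set0Pn.
  by exists x; rewrite inE xA2.
have card_new z : z \in A2 :\: A1 -> #|z |: (A1 :\ x)| = #|S|.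
  rewrite inE => /andP[zA1 _].
  by rewrite cardsU1 !inE (negbTE zA1) andbF -c1 [in RHS](cardsD1 x) xA1.
have sub_new z c : le z c -> z \in A2 :\: A1 ->
    #|[set u in z |: (A1 :\ x) | le u c]| + le x c =
    #|[set u in A1 | le u c]|.+1.
  move=> zc; rewrite inE => /andP[zA1 _].
  have -> : [set u in z |: (A1 :\ x) | le u c]
     = z |: ([set u in A1 | le u c] :\ x).
    apply/setP => u; rewrite !inE; case: eqVneq => [->|_] //=.
    by rewrite andbA.
  rewrite cardsU1 !inE (negbTE zA1) andbF /= add1n addSn.
  by rewrite [in RHS](cardsD1 x) inE xA1 /= addnC.
have sub_old z c : ~~ le z c ->
    #|[set u in z |: (A1 :\ x) | le u c]| <= #|[set u in A1 | le u c]|.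
  move=> zc; apply/subset_leq_card/subsetP => u; rewrite !inE.
  case/andP => /orP[/eqP->|/andP[_ ->] ->] //.
  by rewrite (negbTE zc).
case: (boolP [exists z in A2 :\: A1, le x z]) => [/exists_inP[z zA xz]|nex].
  apply/exists_inP; exists z => //; rewrite inE card_new // eqxx /=.
  apply/gale_leP; first exact: card_new.
  move=> c; apply: leq_trans (g1 c).
  case zc: (le z c); last by apply: sub_old; rewrite zc.
  by have := sub_new z c zc zA; rewrite (le_perm_trans xz zc) addn1 => -[->].
pose z := [arg max_(i > y in A2 :\: A1) val ((w^-1)%g i)].
have [zA zmax] : z \in A2 :\: A1 /\ (forall u, u \in A2 :\: A1 -> le u z).
  by rewrite /z; case: arg_maxnP.
apply/exists_inP; exists z => //; rewrite inE card_new // eqxx /=.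
apply/gale_leP; first exact: card_new.
move=> c; case zc: (le z c); last first.
  by apply: leq_trans (g1 c); apply: sub_old; rewrite zc.
have := sub_new z c zc zA; case xc: (le x c).
  by rewrite addn1 => -[->].
rewrite addn0 => ->; apply: leq_trans (g2 c).
rewrite -(cardsID A2 [set u in A1 | _]) -(cardsID A1 [set u in A2 | _]).
rewrite -addnS; apply: leq_add.
  by apply/eq_leq/eq_card => u; rewrite !inE; do !case: (_ \in _); case: (le _ _).
have -> : [set u in A2 | le u c] :\: A1 = A2 :\: A1.
  apply/setP => u; rewrite !inE; case uA1: (u \in A1) => //=.
  case uA2: (u \in A2) => //=; apply: le_perm_trans zc; apply: zmax.
  by rewrite inE uA1.
rewrite cD; apply/proper_card/properP; split.
  by apply/subsetP => u; rewrite !inE => /and3P[-> ->].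
by exists x; rewrite !inE ?xA2 ?xA1 ?xc ?andbF.
Qed.

End SchubertExchange.

Definition schubert_matroid (n : nat) (w : 'S_n) (S : {set 'I_n}) :
    matroid 'I_n :=
  Matroid (schubert_bases_matroid w S).

Definition is_schubert (n : nat) (M : matroid 'I_n) : bool :=
  [exists w : 'S_n, exists S : {set 'I_n}, M == schubert_matroid w S].

Definition derangement (n : nat) (s : 'S_n) : bool :=
  [forall i, s i != i].

(* Main.v *)
Require Import Defs.
From mathcomp Require Import all_boot all_order all_fingroup.
From mathcomp Require Import zify.

(**
  Reading the indicator word of S along w, the Gale condition bounds |T ∩ F|
  by |S ∩ F| on every initial segment F, and only the segments ending in a
  descent from "not in S" to "in S" matter.  Without loops and coloops the word
  starts in S and ends outside S, so the matroid is given by an ordered set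
  partition A_1, ..., A_m with numbers 0 < a_i < |A_i|, subject to
  |T ∩ (A_1 ∪ ... ∪ A_j)| <= a_1 + ... + a_j for all j and equality |T| = a_1 + ... + a_m.
  These data are determined by the matroid: a_1 + 1 is the girth, A_1 is the
  union of the smallest circuits, and contracting a_1 elements of A_1 gives
  the remaining data.  Hence the count N satisfies
  N(X) = sum over nonempty A ⊆ X of (|A| - 1) N(X \ A).  The number d(X) of
  permutations moving exactly X satisfies the same recurrence, because
  sum_A d(A) = |X|!, and sum_A |A| d(X \ A) counts a point x together with a
  permutation of X \ {x}, giving |X| (|X| - 1)! = |X|! as well.
*)

Set Implicit Arguments.
Unset Strict Implicit.
Unset Printing Implicit Defensive.

(** * Permutations by their set of moved points *)

Section DerangementRecurrence.
Variable T : finType.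
Implicit Types A X : {set T}.

Definition perms_moving X : {set {perm T}} :=
  [set s : {perm T} | [set x | s x != x] == X].

Lemma sum_perms_moving X :
  \sum_(A in powerset X) #|perms_moving A| = #|X|`!.
Proof.
rewrite -card_perm -[RHS]sum1_card.
rewrite (partition_big (fun s : {perm T} => [set x | s x != x])
                       (mem (powerset X))) /=; last first.
  move=> s /subsetP sX; rewrite inE; apply/subsetP => x; rewrite inE.
  exact: sX.
apply: eq_bigr => A; rewrite inE => AX.
rewrite -sum1_card; apply: eq_bigl => s; rewrite inE.
apply/idP/andP => [/eqP sA|[]//]; split; last exact/eqP.
apply: subset_trans AX; rewrite -sA; apply/subsetP => x.
by rewrite !inE.
Qed.

Lemma sum_powersetC (F : {set T} -> nat) X :
  \sum_(A in powerset X) F (X :\: A) = \sum_(A in powerset X) F A.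
Proof.
have DK A : A \subset X -> X :\: (X :\: A) = A by rewrite setDDr setDv set0U => /setIidPr.
rewrite [RHS](reindex_onto (setD X) (setD X)) /=; last first.
  by move=> A; rewrite inE => /DK.
apply: eq_bigl => A; rewrite !inE subsetDl /=.
apply/idP/eqP => [/DK //|<-]; exact: subsetDl.
Qed.

Lemma sum_card_perms_moving X : X != set0 ->
  \sum_(A in powerset X) #|A| * #|perms_moving (X :\: A)| = #|X|`!.
Proof.
move=> X0.
under eq_bigr => A _ do rewrite -sum1_card big_distrl /=.
rewrite (exchange_big_dep (mem X)) /=; last first.
  by move=> A x; rewrite inE => /subsetP; apply.
under eq_bigr => x xX.
  have -> : \sum_(A in powerset X | x \in A) 1 * #|perms_moving (X :\: A)|
            = (#|X|.-1)`!.
    rewrite [in RHS](cardsD1 x) xX -sum_perms_moving -sum_powersetC.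
    (* Deleting [x] matches the sets [A] through [x] with the subsets of [X :\ x] and keeps the
       complement [X :\: A]. *)
    rewrite [RHS](reindex_onto (fun A => A :\ x) (fun A => x |: A)) /=; last first.
      move=> A; rewrite !inE => /subsetP AX; apply/setP => y; rewrite !inE.
      by case: eqVneq => //= ->; apply/esym/negbTE/negP => /AX; rewrite !inE eqxx.
    apply: eq_big => A.
      rewrite !inE; apply/andP/andP => [[AX xA]|[AX /eqP E]].
        by rewrite setSD // setD1K.
      have xA : x \in A by rewrite -E setU11.
      by rewrite xA -(setD1K xA) subUset sub1set xX (subset_trans AX) ?subD1set.
    rewrite inE => /andP[_ xA]; rewrite mul1n; congr #|perms_moving _|.
    apply/setP => y; rewrite !inE.
    by case: eqVneq => [->|]; rewrite ?xA.
  over.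
rewrite sum_nat_const; case: #|X| (card_gt0 X) => [|k _]; last by rewrite factS.
by rewrite X0.
Qed.

Lemma card_perms_moving_rec X : X != set0 ->
  #|perms_moving X| =
  \sum_(A in powerset X) #|A|.-1 * #|perms_moving (X :\: A)|.
Proof.
move=> X0; apply: (@addnI #|X|`!).
rewrite -[in RHS]sum_perms_moving -[in RHS]sum_powersetC -big_split /=.
have -> : #|perms_moving X| =
    \sum_(A in powerset X) (A == set0) * #|perms_moving (X :\: A)|.
  rewrite (bigD1 set0) ?inE ?sub0set //= eqxx mul1n setD0 big1 ?addn0 // => A.
  by case/andP => _ /negbTE->.
rewrite -sum_card_perms_moving // -big_split /=; apply: eq_bigr => A _.
rewrite -mulSn -mulnDl -cards_eq0; congr (_ * _); lia.
Qed.

End DerangementRecurrence.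

(** * Flags of blocks and their bases *)

Section Flags.
Variable T : finType.
Implicit Types (A U V X Y Z : {set T}) (L : seq ({set T} * nat)).

Fixpoint flag X L : bool :=
  if L is (A, a) :: L' then
    [&& A \subset X, 0 < a, a < #|A| & flag (X :\: A) L']
  else X == set0.

Definition rank L := sumn (unzip2 L).

Arguments rank : simpl never.

Lemma rank_cons A a L : rank ((A, a) :: L) = a + rank L.
Proof. by []. Qed.

(* [p] and [q] accumulate the left and right sides over the blocks already
   passed. *)
Fixpoint bounded p q L Y : bool :=
  (p <= q) &&
  (if L is (A, a) :: L' then bounded (p + #|Y :&: A|) (q + a) L' Y else true).

Definition flag_bases X L : {set {set T}} :=
  [set Y : {set T} | [&& Y \subset X, #|Y| == rank L & bounded 0 0 L Y]].

Lemma bounded_le p q L Y : bounded p q L Y -> p <= q.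
Proof. by case: L => [|[A a] L] /= /andP[]. Qed.

Lemma bounded_shift r p q L Y : bounded (p + r) (q + r) L Y = bounded p q L Y.
Proof.
elim: L p q => [|[A a] L IH] p q /=; rewrite leq_add2r //.
by rewrite addnAC (addnAC q) IH.
Qed.

Lemma cardsI_setD_split A X Y : A \subset X ->
  #|Y :&: X| = #|Y :&: A| + #|Y :&: (X :\: A)|.
Proof.
move=> AX; rewrite -(cardsID A (Y :&: X)) -setIA (setIidPr AX).
by rewrite setIDA.
Qed.

Lemma setI_setD X A Y Z : Y :&: X = Z :&: X -> Y :&: (X :\: A) = Z :&: (X :\: A).
Proof. by rewrite !setIDA => ->. Qed.

Lemma setI_subset X A Y Z : A \subset X -> Y :&: X = Z :&: X -> Y :&: A = Z :&: A.
Proof. by move=> /setIidPr <- E; rewrite !setIA E. Qed.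

Lemma bounded_eq p q X L Y Z : flag X L -> Y :&: X = Z :&: X ->
  bounded p q L Y = bounded p q L Z.
Proof.
elim: L p q X => [|[A a] L IH] p q X //= /and4P[AX _ _ vL] YZ.
by rewrite (setI_subset AX YZ) (IH _ _ _ vL (setI_setD A YZ)).
Qed.

(** Each block raises the right side by at least 1, so the first one already absorbs an excess of
    1. *)
Lemma bounded_small p q X L Y : flag X L -> p <= q ->
  p + #|Y :&: X| <= q.+1 -> bounded p q L Y.
Proof.
elim: L p q X => [|[A a] L IH] p q X /=; first by move=> _ ->.
case/and4P => AX a0 _ vL -> /=; rewrite (cardsI_setD_split _ AX) => YX.
by apply: IH vL _ _; lia.
Qed.

Lemma bounded_card p q X L Y : flag X L -> bounded p q L Y ->
  p + #|Y :&: X| <= q + rank L.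
Proof.
elim: L p q X => [|[A a] L IH] p q X /=.
  by move=> /eqP-> /andP[pq _]; rewrite setI0 cards0 !addn0.
case/and4P => AX a0 _ vL /andP[_ /(IH _ _ _ vL)].
by rewrite (cardsI_setD_split _ AX) rank_cons; lia.
Qed.

(* If no single element can be added, every constraint has slack, including the
   initial [p <= q]; starting from [p = q] this is impossible. *)
Lemma bounded_extend1 p q X L Y : flag X L -> bounded p q L Y ->
  p + #|Y :&: X| < q + rank L ->
  (exists2 y, y \in X :\: Y & bounded p q L (y |: Y)) \/ bounded p.+1 q L Y.
Proof.
elim: L p q X => [|[A a] L IH] p q X /=.
  by move=> /eqP-> pq; rewrite setI0 cards0 !addn0 !andbT => lt; right.
case/and4P => AX a0 aA vL /andP[pq bY].
rewrite (cardsI_setD_split _ AX) rank_cons => lt.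
have [|[y yX by_]|bS] := IH _ _ _ vL bY; first by lia.
  left; exists y; first by move: yX; rewrite !inE => /and3P[-> _ ->].
  move: yX; rewrite pq !inE => /and3P[_ yA _].
  have -> // : (y |: Y) :&: A = Y :&: A.
  by apply/setP => z; rewrite !inE; case: eqVneq => // ->; rewrite (negbTE yA) !andbF.
have [AY|/subsetPn[y yA yY]] := boolP (A \subset Y).
  right; rewrite addSn bS andbT.
  by move/bounded_le: bS; rewrite (setIidPr AY); lia.
left; exists y; first by rewrite inE yY (subsetP AX).
have -> : #|(y |: Y) :&: A| = #|Y :&: A|.+1.
  have -> : (y |: Y) :&: A = y |: (Y :&: A).
    by apply/setP => z; rewrite !inE; case: eqVneq => // ->.
  by rewrite cardsU1 inE (negbTE yY).
rewrite addnS pq -(bounded_eq _ _ vL (Y := Y)) //.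
by apply/setP => z; rewrite !inE; case: eqVneq => // ->; rewrite yA !andbF.
Qed.

(** So the subsets of [X] satisfying [bounded] are independent: elements are added one at a time
    until the rank is reached. *)
Lemma bounded_extend X L Y : flag X L -> Y \subset X -> bounded 0 0 L Y ->
  exists2 B, B \in flag_bases X L & Y \subset B.
Proof.
move=> vL; move Dm: (rank L - #|Y|) => m; elim: m Y Dm => [|m IH] Y Dm YX bY.
  exists Y => //; rewrite inE YX bY andbT eqn_leq.
  by have := bounded_card vL bY; rewrite (setIidPl YX); lia.
have [|[y]|/bounded_le //] := bounded_extend1 vL bY.
  by rewrite (setIidPl YX); lia.
rewrite inE => /andP[yY yX] /IH[||B BB /subsetP sB].
- by rewrite cardsU1 yY; lia.
- by rewrite subUset sub1set yX.
by exists B => //; apply/subsetP => z zY; apply: sB; rewrite inE zY orbT.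
Qed.

(** Only the first constraint can fail for so small a set, as the later right sides are at least
    [a.+1]. Hence the smallest circuits are the [a.+1]-subsets of [A]. *)
Lemma flag_cons_extend X A a L Y : flag X ((A, a) :: L) -> Y \subset X ->
  #|Y| <= a.+1 -> #|Y :&: A| <= a ->
  exists2 B, B \in flag_bases X ((A, a) :: L) & Y \subset B.
Proof.
move=> vL YX Ya YA; apply: bounded_extend => //=; case/and4P: vL => AX _ _ vL.
apply: bounded_small vL _ _ => //.
by rewrite -cardsI_setD_split // (setIidPl YX).
Qed.

Lemma flag_bases_card_block X A a L B :
  B \in flag_bases X ((A, a) :: L) -> #|B :&: A| <= a.
Proof. by rewrite inE => /and3P[_ _ /= /bounded_le]. Qed.

Lemma subset_of_card A (k : nat) : k <= #|A| -> exists2 U : {set T}, U \subset A & #|U| = k.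
Proof.
move=> kA; have := cards_draws A k; case: (set_0Vmem [set U : {set T} | U \subset A & #|U| == k]).
  by move=> ->; rewrite cards0 => /esym/eqP; rewrite -leqn0 leqNgt bin_gt0 kA.
by case=> U; rewrite inE => /andP[UA /eqP]; exists U.
Qed.

(** The strict bounds on [k] leave room both to include and to exclude [x]; this later rules out
    loops and coloops. *)
Lemma subset_of_card_mem A (k : nat) x (b : bool) : 0 < k < #|A| ->
  exists U : {set T}, [/\ U \subset A, #|U| = k & x \in A -> (x \in U) = b].
Proof.
case/andP => k0 kA; have [xA|xA] := boolP (x \in A); last first.
  by have [U UA Uk] := subset_of_card (ltnW kA); exists U; split.
have := cardsD1 x A; rewrite xA => cA.
case: b.
  have [|U UA Uk] := @subset_of_card (A :\ x) k.-1; first by lia.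
  exists (x |: U); split; last by rewrite setU11.
    by rewrite subUset sub1set xA (subset_trans UA) // subD1set.
  rewrite cardsU1 Uk; case: (boolP (x \in U)) => [/(subsetP UA)|_]; last by lia.
  by rewrite !inE eqxx.
have [|U UA Uk] := @subset_of_card (A :\ x) k; first by lia.
exists U; split=> //; first by rewrite (subset_trans UA) // subD1set.
by move=> _; apply/negbTE/negP => /(subsetP UA); rewrite !inE eqxx.
Qed.

(* The first block is recovered as the union of the smallest circuits. *)
Lemma flag_bases_first_block X A a L A' a' L' :
  flag X ((A, a) :: L) -> flag X ((A', a') :: L') ->
  flag_bases X ((A, a) :: L) = flag_bases X ((A', a') :: L') ->
  a <= a' -> a = a' /\ A \subset A'.
Proof.
move=> vL vL' E aa'.
(* Such a [U] is dependent, so [flag_cons_extend] must fail for the second flag. Its size condition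
   holds because [a <= a'], hence [a' < #|U :&: A'| <= a.+1]. *)
have dep (U : {set T}) : U \subset A -> #|U| = a.+1 -> a = a' /\ U \subset A'.
  move=> UA Ua; have AX : A \subset X by case/and4P: vL.
  have : ~~ (#|U :&: A'| <= a').
    apply/negP => /(flag_cons_extend vL')[||B].
    - exact: subset_trans UA AX.
    - by rewrite Ua ltnS.
    rewrite -E => /flag_bases_card_block BA UB.
    suff : a.+1 <= a by rewrite ltnn.
    by apply: leq_trans BA; rewrite -Ua subset_leq_card // subsetI UB.
  rewrite -ltnNge => lt; have le := subset_leq_card (subsetIl U A').
  have aE : a = a' by lia.
  split=> //; apply/setIidPl/eqP; rewrite eqEcard subsetIl /=; lia.
have /and4P[_ a0 aA _] := vL.
have [U UA Ua] := subset_of_card aA; split; first by case: (dep _ UA Ua).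
(* Since [a < #|A|], each [x] of [A] lies in some [a.+1]-subset of [A]. *)
apply/subsetP => x xA; have := cardsD1 x A; rewrite xA => cA.
have [|V VA Va] := @subset_of_card (A :\ x) a; first by lia.
have [||_ /subsetP] := dep (x |: V); last by apply; rewrite setU11.
  by rewrite subUset sub1set xA (subset_trans VA) // subD1set.
by rewrite cardsU1 Va; case: (boolP (x \in V)) => // /(subsetP VA); rewrite !inE eqxx.
Qed.

(** This is contraction by [U]: the first constraint becomes tight, and both sides of the later ones
    start from [a], which [bounded_shift] cancels. *)
Lemma flag_bases_tail X A a L U Y : flag X ((A, a) :: L) ->
  U \subset A -> #|U| = a -> Y \subset X :\: A ->
  (Y \in flag_bases (X :\: A) L) = (U :|: Y \in flag_bases X ((A, a) :: L)).
Proof.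
case/and4P => AX a0 aA vL UA Ua YX; rewrite !inE /= YX rank_cons.
have dYA : Y :&: A = set0.
  apply/setP => z; rewrite !inE; apply/negP => /andP[/(subsetP YX)].
  by rewrite inE => /andP[/negbTE->].
have dUY : U :&: Y = set0.
  by apply/eqP; rewrite -subset0 -dYA subsetI subsetIr (subset_trans (subsetIl _ _)).
rewrite subUset (subset_trans UA AX) (subset_trans YX (subsetDl _ _)) /=.
rewrite cardsU dUY cards0 subn0 Ua eqn_add2l; congr andb.
rewrite setIUl dYA setU0 (setIidPl UA) Ua -(bounded_shift a 0 0).
apply: bounded_eq vL _; rewrite setIUl; apply/esym/setUidPr.
apply/subsetP => z; rewrite !inE => /and3P[/(subsetP UA)->].
by [].
Qed.

Lemma flag_bases_inj X L L' : flag X L -> flag X L' ->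
  flag_bases X L = flag_bases X L' -> L = L'.
Proof.
elim: L L' X => [|[A a] L IH] [|[A' a'] L'] X //.
- move=> /eqP-> /and4P[]; rewrite subset0 => /eqP->.
  by rewrite cards0.
- move=> /and4P[+ _ +] _ /eqP X0; rewrite X0 subset0 => /eqP->.
  by rewrite cards0.
move=> vL vL' E.
have aE : a = a'.
  by case/orP: (leq_total a a') => le;
     [case: (flag_bases_first_block vL vL' E le)
     |case: (flag_bases_first_block vL' vL (esym E) le)].
rewrite -{a'}aE in vL' E *.
have AE : A = A'.
  apply/eqP; rewrite eqEsubset.
  by case: (flag_bases_first_block vL vL' E (leqnn _)) => _ ->;
     case: (flag_bases_first_block vL' vL (esym E) (leqnn _)) => _ ->.
rewrite -{A'}AE in vL' E *.
congr cons; apply: (IH _ (X :\: A)); [by case/and4P: vL | by case/and4P: vL' |].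
have [U UA Ua] : exists2 U : {set T}, U \subset A & #|U| = a.
  by apply: subset_of_card; apply: ltnW; case/and4P: vL.
apply/setP => Y; have [YX|YX] := boolP (Y \subset X :\: A).
  by rewrite (flag_bases_tail vL UA Ua YX) (flag_bases_tail vL' UA Ua YX) E.
by rewrite !inE (negbTE YX).
Qed.

End Flags.

(** * Gale order along words *)

Section Words.
Variable T : finType.
Implicit Types (A S U X Y : {set T}) (L : seq ({set T} * nat)) (s : seq T).

(** The Gale condition by prefix counts, with accumulators as in [bounded] but a constraint after
    every letter. Compressing runs of letters turns it into [bounded]. *)
Fixpoint dominated p q s S Y : bool :=
  (p <= q) &&
  (if s is x :: s' then dominated (p + (x \in Y)) (q + (x \in S)) s' S Y
   else true).

Lemma dominated_le p q s S Y : dominated p q s S Y -> p <= q.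
Proof. by case: s => [|x s] /= /andP[]. Qed.

Lemma eq_in_dominated p q s S S' Y : {in s, S =i S'} ->
  dominated p q s S Y = dominated p q s S' Y.
Proof.
elim: s p q => [|x s IH] p q //= SS'.
rewrite SS' ?mem_head // IH // => y ys.
by apply: SS'; rewrite inE ys orbT.
Qed.

Lemma dominatedP p q s S Y :
  reflect (forall k, p + count [in Y] (take k s) <= q + count [in S] (take k s))
          (dominated p q s S Y).
Proof.
elim: s p q => [|x s IH] p q /=.
  by rewrite andbT !addn0; apply: (iffP idP) => [pq _|/(_ 0)//].
apply: (iffP andP) => [[pq /IH H] [|k] /=|H].
- by rewrite !addn0.
- by rewrite !addnA.
split; first by have := H 0; rewrite /= !addn0.
by apply/IH => k; have := H k.+1; rewrite /= !addnA.
Qed.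

(** Along a run inside [S] the right side gains 1 per letter and the left at most 1, so the first
    constraint implies the others. *)
Lemma dominated_cat_in p q s1 s2 S Y : {subset s1 <= S} ->
  dominated p q (s1 ++ s2) S Y =
  (p <= q) && dominated (p + count [in Y] s1) (q + size s1) s2 S Y.
Proof.
elim: s1 p q => [|x s1 IH] p q /= sS.
  rewrite !addn0; apply/idP/andP => [d|[]//]; split=> //.
  exact: dominated_le d.
rewrite sS ?mem_head // IH; last by move=> y ys; rewrite sS // inE ys orbT.
rewrite !addnA addn1 addnS addSn; case: leqP => //= pq.
by case: (x \in Y); rewrite /= ?addn1 ?ltnS ?addn0 ?pq // (leqW pq).
Qed.

(** Along a run outside [S] the right side is constant and the left only grows, so the last
    constraint implies the others. *)
Lemma dominated_cat_notin p q s1 s2 S Y : {in s1, forall x, x \notin S} ->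
  dominated p q (s1 ++ s2) S Y = dominated (p + count [in Y] s1) q s2 S Y.
Proof.
elim: s1 p q => [|x s1 IH] p q /= sS; first by rewrite addn0.
rewrite (negbTE (sS x _)) ?mem_head // addn0 IH.
  rewrite addnA; apply/andP/idP => [[]//|d]; split=> //.
  by have := dominated_le d; lia.
by move=> y ys; rewrite sS // inE ys orbT.
Qed.

Lemma count_mem_card s Y : uniq s -> count [in Y] s = #|Y :&: [set x in s]|.
Proof.
move=> us; rewrite -size_filter -(card_uniqP (filter_uniq _ us)).
by apply: eq_card => x; rewrite mem_filter !inE.
Qed.

Lemma dominated_block p q s1 s2 s S Y :
    {subset s1 <= S} -> {in s2, forall x, x \notin S} -> uniq (s1 ++ s2) ->
  dominated p q (s1 ++ s2 ++ s) S Y =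
  (p <= q) && dominated (p + #|Y :&: [set x in s1 ++ s2]|) (q + size s1) s S Y.
Proof.
move=> h1 h2 u; rewrite dominated_cat_in // dominated_cat_notin //.
by rewrite -count_mem_card // count_cat addnA.
Qed.

(** Each block is spelled as [a] letters put into [S] followed by its remaining letters. The freedom
    given by [x] and [b] will produce bases through or avoiding a given point. *)
Lemma flag_word X L x b : flag X L -> exists s S,
  [/\ uniq s, [set y in s] = X, S \subset X /\ #|S| = rank L,
      x \in X -> (x \in S) = b
    & forall p q Y, dominated p q s S Y = bounded p q L Y].
Proof.
elim: L X => [|[A a] L IH] X /=.
  move=> /eqP->; exists [::], set0; split=> //.
  - by rewrite cards0 sub0set.
  - by rewrite inE.
case/and4P => AX a0 aA /IH[s [S [us sX [SX Sr] xS dS]]].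
have [|U [UA Ua xU]] := @subset_of_card_mem _ A a x b; first by rewrite a0.
have sE y : (y \in s) = (y \in X :\: A) by rewrite -sX inE.
have AE : [set y in enum U ++ enum (A :\: U)] = A.
  apply/setP => y; rewrite inE mem_cat !mem_enum !inE.
  by have := subsetP UA y; case: (y \in U) => //= ->.
have SA y : y \in S -> (y \in X) && (y \notin A).
  by move/(subsetP SX); rewrite inE andbC.
have uA : uniq (enum U ++ enum (A :\: U)).
  rewrite cat_uniq !enum_uniq andbT /=; apply/hasPn => y.
  by rewrite !mem_enum inE => /andP[].
exists (enum U ++ enum (A :\: U) ++ s), (U :|: S); split.
- rewrite catA cat_uniq uA us andbT /=; apply/hasPn => y; rewrite sE inE.
  by rewrite mem_cat !mem_enum !inE => /andP[yA _]; rewrite (negbTE yA) andbF orbF;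
     apply: contra yA => /(subsetP UA).
- apply/setP => y; rewrite inE catA mem_cat sE.
  have /setP/(_ y) := AE; rewrite inE => ->.
  by rewrite inE; have := subsetP AX y; case: (y \in A) => //= ->.
- split.
    rewrite subUset (subset_trans UA AX); apply/subsetP => y /SA.
    by case/andP.
  rewrite cardsU rank_cons Ua Sr (_ : U :&: S = set0) ?cards0 ?subn0 //.
  apply/setP => y; rewrite !inE; apply/andP => -[/(subsetP UA) yA /SA].
  by rewrite yA andbF.
- move=> xX; rewrite inE; have [xA|xA] := boolP (x \in A).
    by rewrite xU // (_ : (x \in S) = false) ?orbF //; apply/negP => /SA; rewrite xA andbF.
  rewrite xS ?inE ?xA // (_ : x \in U = false) //.
  by apply/negbTE; apply: contra xA => /(subsetP UA).
move=> p q Y; rewrite dominated_block // ?AE -?cardE ?Ua.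
- rewrite -dS; congr andb; apply: eq_in_dominated => y; rewrite sE !inE.
  by case/andP => yA _; case yU: (y \in U) => //; rewrite (subsetP UA) in yA.
- by move=> y; rewrite mem_enum inE => ->.
move=> y; rewrite mem_enum !inE negb_or => /andP[-> yA] /=.
by apply/negP => /SA; rewrite yA andbF.
Qed.

Lemma split_prefix (P : pred T) s : exists s1 s2,
  [/\ s = s1 ++ s2, {in s1, forall x, P x}
    & forall x s', s2 = x :: s' -> ~~ P x].
Proof.
elim: s => [|x s [s1 [s2 [-> P1 P2]]]]; first by exists [::], [::].
have [Px|Px] := boolP (P x); last first.
  by exists [::], (x :: s1 ++ s2); split=> // _ _ [<- _].
exists (x :: s1), s2; split=> // y; rewrite inE => /predU1P[->|/P1] //.
Qed.

(** Cut the word into maximal runs, alternately inside and outside [S]. The conditions on the first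
    and last letters pair these runs into blocks with both parts nonempty. *)
Lemma word_flag s S : uniq s ->
    (forall x s', s = x :: s' -> x \in S /\ last x s' \notin S) ->
  exists L, [/\ flag [set x in s] L, rank L = #|S :&: [set x in s]|
    & forall p q Y, dominated p q s S Y = bounded p q L Y].
Proof.
move: {2}(size s) (leqnn (size s)) => m; elim: m s => [|m IH] [|x s] //.
1,2: move=> _ _ _; exists [::].
1,2: have -> : [set x in [::]] = set0 :> {set T} by apply/setP => x; rewrite !inE.
1,2: by rewrite /= setI0 cards0.
move=> sz us /(_ x s erefl)[xS lS].
have [s1 [s23 [E h1 h23]]] := split_prefix [in S] (x :: s).
have s1_gt0 : 0 < size s1.
  by case: s1 E h1 h23 => //= <- _ /(_ x s erefl); rewrite xS.
have [s2 [s3 [E2 h2 h3]]] := split_prefix [predC S] s23.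
(* Otherwise the whole word would lie in [S], contrary to its last letter. *)
have s2_gt0 : 0 < size s2.
  case: s2 E2 h2 h3 => //= E2 _ h3; case: s23 E h23 E2 => [|y s23] E h23 E2.
    by rewrite cats0 in E; rewrite -E in h1; rewrite (h1 _ (mem_last x s)) in lS.
  by have := h3 _ _ (esym E2); rewrite /= (h23 y s23 erefl).
rewrite {}E2 {h23} in E.
have := us; rewrite {1}E catA cat_uniq => /and3P[u12 /hasPn d3 u3].
have [|//|z s' E3|L [fL rL dL]] := IH s3.
- move/(congr1 size): E; rewrite !size_cat /= => E; move: sz; rewrite /=; lia.
- split; first by move/negbNE: (h3 z s' E3).
  suff <- : last x s = last z s' by [].
  by rewrite -[last x s]/(last x (x :: s)) E E3 !last_cat.
have cA : #|[set y in s1 ++ s2]| = size s1 + size s2.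
  by rewrite cardsE (card_uniqP u12) size_cat.
exists (([set y in s1 ++ s2], size s1) :: L); split.
- rewrite /= cA s1_gt0 -[X in X < _]addn0 ltn_add2l s2_gt0 /= E; apply/andP; split.
    by apply/subsetP => y; rewrite !inE !mem_cat orbA => ->.
  rewrite (_ : _ :\: _ = [set y in s3]) //; apply/setP => y.
  have := d3 y; rewrite !inE !mem_cat orbA.
  by case: (y \in s3) => [/(_ isT) ->|]; rewrite ?orbT // orbF andNb.
- rewrite rank_cons rL -!count_mem_card // E !count_cat.
  have -> : count [in S] s1 = size s1 by apply/eqP; rewrite -all_count; apply/allP.
  have -> // : count [in S] s2 = 0.
  by apply/eqP; rewrite -leqn0 leqNgt -has_count; apply/hasPn.
by move=> p q Y; rewrite E dominated_block //= dL.
Qed.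

End Words.

(** * Counting *)

Section FlagCount.
Variable T : finType.
Implicit Types (A X : {set T}) (L : seq ({set T} * nat)).

Definition blocks X : seq ({set T} * nat) :=
  [seq (A, a) | A <- enum (powerset X), a <- iota 1 #|A|.-1].

(* [m] is recursion fuel; the list is complete as soon as [#|X| <= m]. *)
Fixpoint flags m X : seq (seq ({set T} * nat)) :=
  if m is m'.+1 then
    if X == set0 then [:: [::]]
    else [seq Aa :: L | Aa <- blocks X, L <- flags m' (X :\: Aa.1)]
  else [:: [::]].

Lemma mem_blocks X A a :
  ((A, a) \in blocks X) = [&& A \subset X, 0 < a & a < #|A|].
Proof.
apply/allpairsPdep/and3P => [[B [b [BX bB [-> ->]]]]|[AX a0 aA]].
  by move: BX bB; rewrite mem_enum inE mem_iota => -> ?; split=> //; lia.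
by exists A, a; rewrite mem_enum inE mem_iota AX; split=> //; lia.
Qed.

Lemma blocks_uniq X : uniq (blocks X).
Proof.
apply: allpairs_uniq_dep => [||[A a] [B b] _ _ /= [-> ->]] //.
- exact: enum_uniq.
- by move=> A _; apply: iota_uniq.
Qed.

Lemma card_setD_block X A (m : nat) : #|X| <= m.+1 -> A \subset X -> 0 < #|A| ->
  #|X :\: A| <= m.
Proof. by rewrite cardsD => Xm /setIidPr->; lia. Qed.

Lemma flag_set0 L : flag set0 L = (L == [::]).
Proof.
case: L => [|[A a] L] /=; first by rewrite eqxx.
by rewrite subset0; apply/negbTE/and4P => -[/eqP->]; rewrite cards0.
Qed.

Lemma mem_flags m X L : #|X| <= m -> (L \in flags m X) = flag X L.
Proof.
elim: m X L => [|m IH] X L Xm /=.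
  have X0 : X = set0 by apply/eqP; rewrite -cards_eq0 -leqn0.
  by rewrite X0 flag_set0 inE.
case: eqVneq => [->|X0]; first by rewrite flag_set0 inE.
case: L => [|[A a] L] /=.
  by rewrite (negbTE X0); apply/negbTE/negP => /allpairsPdep[? [? []]].
apply/allpairsPdep/idP => [[[B b] [L' []]]|/and4P[AX a0 aA vL]].
  rewrite mem_blocks => /and3P[BX b0 bB] + [-> -> ->].
  rewrite IH /= => [->|]; first by rewrite BX b0 bB.
  by apply: (card_setD_block Xm BX); lia.
exists (A, a), L; rewrite mem_blocks AX a0 aA /= IH //.
by apply: (card_setD_block Xm AX); lia.
Qed.

Lemma flags_uniq m X : uniq (flags m X).
Proof.
elim: m X => //= m IH X; case: ifP => // _.
apply: allpairs_uniq_dep => [||[Aa L] [Bb L'] _ _ /= [-> ->]] //.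
exact: blocks_uniq.
Qed.

Lemma size_flags m X : #|X| <= m -> size (flags m X) = #|perms_moving X|.
Proof.
have p0 : #|@perms_moving T set0| = 1.
  have := sum_perms_moving (set0 : {set T}).
  by rewrite powerset0 big_set1 cards0.
elim: m X => [|m IH] X Xm /=.
  suff -> : X = set0 by rewrite p0.
  by apply/eqP; rewrite -cards_eq0 -leqn0.
case: eqVneq => [->|X0] /=; first by rewrite p0.
rewrite size_allpairs_dep sumnE big_map big_allpairs_dep /=.
rewrite card_perms_moving_rec // big_enum /=; apply: eq_bigr => A.
rewrite inE => AX; rewrite big_const_seq count_predT size_iota iter_addn_0 mulnC.
(* An empty [A] does not shrink [X], but its factor [#|A|.-1] is 0. *)
case: (posnP #|A|) => [->|A0]; first by rewrite !mul0n.
by rewrite IH // (card_setD_block Xm AX).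
Qed.

End FlagCount.

(** * Loopless and coloopless Schubert matroids as flags *)

Section SchubertFlags.
Variable n : nat.
Implicit Types (w : 'S_n) (S Y : {set 'I_n}).

Definition word w : seq 'I_n := [seq w i | i <- enum 'I_n].

Lemma word_uniq w : uniq (word w).
Proof. by rewrite map_inj_uniq ?enum_uniq //; apply: perm_inj. Qed.

Lemma mem_word w i : i \in word w.
Proof. by apply/mapP; exists (w^-1 i)%g; rewrite ?mem_enum ?permKV. Qed.

Lemma set_word w : [set i in word w] = setT.
Proof. by apply/setP => i; rewrite !inE mem_word. Qed.

Lemma word_surj (s : seq 'I_n) : uniq s -> [set i in s] = setT ->
  exists w, word w = s.
Proof.
move=> us sT; have sz : size s = n.
  by rewrite -(card_uniqP us) -cardsE sT cardsT card_ord.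
(* The default of [nth] is [i] itself, since ['I_n] may be empty; it is never reached because [s]
   has length [n]. *)
have inj : injective (fun i : 'I_n => nth i s i).
  move=> i j; rewrite (set_nth_default i) ?sz // => /eqP.
  by rewrite nth_uniq ?sz // => /eqP/val_inj.
exists (perm inj); have sw : size (word (perm inj)) = size s by rewrite size_map size_enum_ord.
have [s0|] := posnP (size s).
  by rewrite [RHS](size0nil s0); apply: size0nil; rewrite sw.
rewrite {1}sz => n0; apply: (eq_from_nth (x0 := Ordinal n0)) => // i; rewrite sw sz => ltin.
rewrite (nth_map (Ordinal n0)) ?size_enum_ord // permE -[i in LHS]/(val (Ordinal ltin)) nth_ord_enum.
by apply: set_nth_default; rewrite sz.
Qed.

Lemma card_below w Y (i : 'I_n) :
  #|[set z in Y | le_perm w z (w i)]| = count [in Y] (take i.+1 (word w)).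
Proof.
rewrite count_mem_card ?take_uniq ?word_uniq //; apply: eq_card => z.
rewrite !inE; congr andb; rewrite /le_perm permK /word -map_take.
rewrite -{2}(permKV w z) mem_map; last exact: perm_inj.
by rewrite in_take ?mem_enum // index_enum_ord.
Qed.

Lemma schubert_basesE w S :
  schubert_bases w S = [set Y : {set 'I_n} | (#|Y| == #|S|) && dominated 0 0 (word w) S Y].
Proof.
apply/setP => Y; rewrite !inE; case: eqP => //= cYS.
apply/(gale_leP w cYS)/dominatedP => H.
  (* Prefixes of length 1 to [n] are the segments below some [w k]; longer ones are the whole word,
     where the cardinalities agree. *)
  case=> [|k]; first by rewrite take0.
  rewrite !add0n; have [kn|kn] := ltnP k n.
    by have := H (w (Ordinal kn)); rewrite !card_below.
  rewrite take_oversize; last by rewrite size_map size_enum_ord leqW.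
  by rewrite !count_mem_card ?word_uniq // set_word !setIT cYS.
by move=> c; rewrite -(permKV w c) !card_below; apply: H.
Qed.

Definition lc_schubert : {set matroid 'I_n} :=
  [set M : matroid 'I_n | [&& is_schubert M, loopless M & coloopless M]].

Lemma lc_schubert_flag M : M \in lc_schubert ->
  exists2 L, flag setT L & bases M = flag_bases setT L.
Proof.
rewrite inE => /and3P[/existsP[w /existsP[S /eqP->]] /forallP lp /forallP clp].
have [|L [fL rL dL]] := word_flag (S := S) (word_uniq w); last first.
  exists L; rewrite -?(set_word w) //.
  apply/setP => Y; rewrite [bases _]schubert_basesE !inE dL rL set_word.
  by rewrite setIT subsetT.
move=> x s E; have uw := word_uniq w; split.
  (* For a basis through the first letter, the prefix of length 1 forces that letter into [S]. *)
  have /exists_inP[B + xB] := lp x.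
  rewrite [bases _]schubert_basesE inE E /= xB => /andP[_ /dominated_le].
  by case: (x \in S).
(* A basis avoiding the last letter has all its elements before it, so [S] also has all of its
   elements there. *)
have := clp (last x s); rewrite negb_forall => /existsP[B].
rewrite negb_imply [bases _]schubert_basesE inE => /andP[/andP[/eqP cB]].
rewrite -[last x s]/(last x (x :: s)) -E => /dominatedP d.
have wT (Y : {set 'I_n}) : #|Y| = count [in Y] (word w).
  by rewrite count_mem_card // set_word setIT.
move: cB; rewrite !wT; move: d; rewrite E lastI.
move/(_ (size (belast x s))); rewrite last_rcons -cats1 take_size_cat // !add0n.
rewrite !count_cat /= !addn0 => d cB yB; apply/negP => yS.
by move: cB; rewrite (negbTE yB) yS addn0 addn1 => cB; rewrite cB ltnn in d.
Qed.

Lemma dominated_refl p (s : seq 'I_n) S : dominated p p s S S.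
Proof. exact/dominatedP. Qed.

Lemma flag_lc_schubert L : 0 < n -> flag [set: 'I_n] L ->
  exists2 M, M \in lc_schubert & bases M = flag_bases setT L.
Proof.
move=> n0 fL.
have [s [S [us sT [_ rS] _ dS]]] := flag_word (Ordinal n0) true fL.
have [w ws] := word_surj us sT.
have bE : bases (schubert_matroid w S) = flag_bases setT L.
  rewrite [LHS]schubert_basesE; apply/setP => Y.
  by rewrite !inE subsetT ws dS rS.
(* The set [S'] of any word spelling the flag is itself a basis, and [flag_word] lets it contain or
   avoid [x] as prescribed by [b]. *)
have basis_thru x b : exists2 B, B \in flag_bases setT L & (x \in B) = b.
  have [s' [S' [_ _ [_ rS'] xS' dS']]] := flag_word x b fL.
  exists S'; last exact: xS'.
  by rewrite inE subsetT rS' eqxx -dS' dominated_refl.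
exists (schubert_matroid w S) => //; rewrite inE; apply/and3P; split.
- by apply/existsP; exists w; apply/existsP; exists S.
- by apply/forallP => x; apply/exists_inP; rewrite bE; apply: basis_thru.
apply/forallP => x; have [B BL xB] := basis_thru x false.
apply/negP => /forall_inP/(_ B); rewrite bE xB => /(_ BL).
by [].
Qed.

(** Matroids and flags both embed injectively into families of sets through their bases, and the two
    images coincide. *)
Lemma card_lc_schubert : 0 < n -> #|lc_schubert| = #|@perms_moving 'I_n setT|.
Proof.
move=> n0; set F := flags n [set: 'I_n].
have cT : #|[set: 'I_n]| <= n by rewrite cardsT card_ord.
have uF : uniq (map (flag_bases setT) F).
  rewrite map_inj_in_uniq ?flags_uniq // => L L'.
  by rewrite !mem_flags //; apply: flag_bases_inj.
rewrite -(size_flags cT) -(size_map (flag_bases setT)) -(card_uniqP uF).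
rewrite -(card_imset _ (@val_inj _ _ (matroid 'I_n))); apply: eq_card => B.
apply/imsetP/mapP => [[M /lc_schubert_flag[L fL ML] ->]|[L + ->]].
  by exists L; rewrite ?mem_flags.
by rewrite mem_flags // => /(flag_lc_schubert n0)[M ML ME]; exists M.
Qed.

End SchubertFlags.

Theorem corollary1p10 (n : nat) (hn : (0 < n)%N) :
  #|[set M : matroid 'I_n | [&& is_schubert M, loopless M & coloopless M]]|
  = #|[set s : 'S_n | derangement s]|.
Proof.
rewrite [LHS]card_lc_schubert //; apply: eq_card => s; rewrite !inE.
apply/eqP/forallP => [/setP sT i|sT]; first by have := sT i; rewrite !inE.
by apply/setP => i; rewrite !inE sT.
Qed.
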